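(* Let $S$ be a commutative unital ring, $\sigma\in\mathrm{Aut}(S)$ of finite order, let $\alpha,b\in S$ both be non-zero-divisors, let $n\in\mathbb{N}$ and $1\le k<n$. Consider the monomial $z=\alpha t^k$ in the Petit ring $\mathbb{S}_{t^n-b}$. If $z$ is power-associative, then $$\alpha b=\sigma^{n}(\alpha)\sigma^k(b).$$ Conversely, if $\alpha b=\sigma^{n}(\alpha)\sigma^k(b)$, then $z$ is power-associative (that is, for every integer $s\ge 1$ the power $(\alpha t^k)^s$ is well-defined in $\mathbb{S}_{t^n-b}$) and for every $s\ge 1$ $$z^s=N_s^{\sigma^k}(\alpha)\left(\prod_{i=1}^{\lfloor sk/n\rfloor}\sigma^{sk-in}(b)\right)t^{[sk]_n},$$ where $[sk]_n=sk-\lfloor sk/n\rfloor n$ is the residue of $sk$ modulo $n$ in $[0,n-1]$.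
   Context: Rings $S$ are commutative, associative, with $1\ne 0$. $S[t;\sigma]$ is the skew polynomial ring with $tc=\sigma(c)t$ for $c\in S$. For a monic $f\in S[t;\sigma]$ of degree $n$, every $g\in S[t;\sigma]$ can be written uniquely as $g=qf+r$ with $\deg r<n$; write $r=g \bmod_r f$. The Petit ring $\mathbb{S}_f$ is the additive group of skew polynomials of degree $<n$ with multiplication $g\circ h=gh \bmod_r f$; it is a unital, in general nonassociative, ring containing $S$ as the constants. For an automorphism $\rho$ of $S$, $N_i^{\rho}(\beta)=\prod_{j=0}^{i-1}\rho^j(\beta)$. An element $z$ of a nonassociative ring is power-associative if all its powers are well-defined: for every $s\ge1$ all parenthesizations of the product of $s$ copies of $z$ agree (equivalently $z^uz^v=z^vz^u$ for all $u,v\geq 1$). *)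

(* Defs.v *)
From HB Require Import structures.
From mathcomp Require Import all_boot ssralg poly.

Set Implicit Arguments.
Unset Strict Implicit.
Unset Printing Implicit Defensive.

Import GRing.Theory.
Local Open Scope ring_scope.

Section Iterates.
Variables (S : pzRingType) (sigma : {rmorphism S -> S}).

Lemma iter_rmorph0 i : iter i sigma 0 = 0.
Proof. by elim: i => //= i ->; rewrite rmorph0. Qed.

Lemma iter_rmorph1 i : iter i sigma 1 = 1.
Proof. by elim: i => //= i ->; rewrite rmorph1. Qed.

Lemma iter_rmorphD i : {morph iter i sigma : x y / x + y}.
Proof. by move=> x y; elim: i => //= i ->; rewrite rmorphD. Qed.

Lemma iter_rmorphM i : {morph iter i sigma : x y / x * y}.
Proof. by move=> x y; elim: i => //= i ->; rewrite rmorphM. Qed.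

Lemma iter_rmorph_sum i n (F : 'I_n -> S) :
  iter i sigma (\sum_(j < n) F j) = \sum_(j < n) iter i sigma (F j).
Proof. exact: (big_morph _ (iter_rmorphD i) (iter_rmorph0 i)). Qed.

End Iterates.

(* N_i^rho(beta) = beta * rho(beta) * ... * rho^(i-1)(beta) *)
Definition skew_norm (S : pzRingType) (rho : S -> S) (i : nat) (beta : S) : S :=
  \prod_(0 <= j < i) iter j rho beta.

(* S[t; sigma]: the additive group, the degree and the coefficients are those *)
(* of {poly S}; only the product is twisted, so that t * c = sigma(c) * t.    *)
Definition skewpoly (S : comNzRingType) (sigma : {rmorphism S -> S}) : Type :=
  {poly S}.

Section SkewPoly.
Variables (S : comNzRingType) (sigma : {rmorphism S -> S}).
Local Notation skew := (skewpoly sigma).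

HB.instance Definition _ := GRing.Zmodule.on skew.

Definition skew_mul (p q : skew) : skew :=
  \poly_(k < (size p + size q).-1)
    \sum_(i < k.+1) p`_i * iter i sigma q`_(k - i).

Lemma coef_skew_mul (p q : skew) k :
  (skew_mul p q)`_k = \sum_(i < k.+1) p`_i * iter i sigma q`_(k - i).
Proof.
rewrite /skew_mul coef_poly; case: ltnP => // le_pq_k.
rewrite big1 // => -[i /= lti] _.
have [lt_ip | /leq_sizeP->] := ltnP i (size p); rewrite ?mul0r //.
have [lt_kq | /leq_sizeP->] := ltnP (k - i) (size q);
  rewrite ?iter_rmorph0 ?mulr0 //.
have le_ik : (i <= k)%N by rewrite -ltnS.
suff: (k < (size p + size q).-1)%N by rewrite ltnNge le_pq_k.
have := leq_add lt_ip lt_kq; rewrite addSn addnS subnKC //.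
by case: (_ + _)%N.
Qed.

Lemma coef_skew_mul_rev (p q : skew) k :
  (skew_mul p q)`_k = \sum_(i < k.+1) p`_(k - i) * iter (k - i) sigma q`_i.
Proof.
rewrite coef_skew_mul (reindex_inj rev_ord_inj) /=.
by apply: eq_bigr => j _; rewrite (sub_ordK j).
Qed.

Fact skew_mulA : associative skew_mul.
Proof.
move=> p q r; apply/polyP=> i; rewrite coef_skew_mul coef_skew_mul_rev.
pose coef3 j k := p`_j *
  (iter j sigma q`_(i - j - k) * iter (i - k) sigma r`_k).
transitivity (\sum_(j < i.+1) \sum_(k < i.+1 | k <= i - j) coef3 j k).
  apply: eq_bigr => /= j _; rewrite coef_skew_mul_rev iter_rmorph_sum.
  rewrite big_distrr /= (big_ord_narrow_leq (leq_subr _ _)).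
  apply: eq_bigr => k _; rewrite /coef3 iter_rmorphM -iterD /=.
  have le_kij : k <= i - j by rewrite -ltnS.
  have le_ji : j <= i by rewrite -ltnS.
  by rewrite subnAC subnKC // leq_subRL ?(leq_trans le_kij) ?leq_subr //
    addnC -leq_subRL.
rewrite (exchange_big_dep predT) //=; apply: eq_bigr => k _.
transitivity (\sum_(j < i.+1 | j <= i - k) coef3 j k).
  apply: eq_bigl => j; rewrite -ltnS -(ltnS j) -!subSn ?leq_ord //.
  by rewrite -subn_gt0 -(subn_gt0 j) -!subnDA addnC.
rewrite (big_ord_narrow_leq (leq_subr _ _)) coef_skew_mul big_distrl /=.
by apply: eq_bigr => j _; rewrite /coef3 -!subnDA addnC mulrA.
Qed.

Fact skew_mul1p : left_id (1%:P : skew) skew_mul.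
Proof.
move=> p; apply/polyP => i; rewrite coef_skew_mul big_ord_recl subn0.
by rewrite big1 => [|j _]; rewrite coefC /= ?mul0r ?mul1r ?addr0.
Qed.

Fact skew_mulp1 : right_id (1%:P : skew) skew_mul.
Proof.
move=> p; apply/polyP => i; rewrite coef_skew_mul_rev big_ord_recl subn0.
rewrite big1 => [|j _]; rewrite coefC /= ?iter_rmorph0 ?iter_rmorph1.
  by rewrite mulr1 addr0.
by rewrite mulr0.
Qed.

Fact skew_mulDl : left_distributive skew_mul +%R.
Proof.
move=> p q r; apply/polyP=> i; rewrite coefD !coef_skew_mul -big_split.
by apply: eq_bigr => j _; rewrite coefD mulrDl.
Qed.

Fact skew_mulDr : right_distributive skew_mul +%R.
Proof.
move=> p q r; apply/polyP=> i; rewrite coefD !coef_skew_mul -big_split.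
by apply: eq_bigr => j _; rewrite coefD iter_rmorphD mulrDr.
Qed.

Fact skew_oner_neq0 : (1%:P : skew) != 0.
Proof. exact: oner_neq0. Qed.

HB.instance Definition _ := GRing.Zmodule_isNzRing.Build skew
  skew_mulA skew_mul1p skew_mulp1 skew_mulDl skew_mulDr skew_oner_neq0.

Definition skewC (c : S) : skew := c%:P.
Definition skewX : skew := 'X.

Lemma coef_skewM (p q : skew) k :
  (p * q)`_k = \sum_(i < k.+1) p`_i * iter i sigma q`_(k - i).
Proof. exact: coef_skew_mul. Qed.

Lemma skewXnE n : skewX ^+ n = 'X^n :> {poly S}.
Proof.
elim: n => [|n IHn]; first by rewrite !expr0.
apply/polyP => k; rewrite exprS coef_skewM IHn coefXn.
case: k => [|k].
  by rewrite big_ord_recl big_ord0 coefX mul0r addr0.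
rewrite big_ord_recl big_ord_recl coefX mul0r add0r big1 => [|j _].
  by rewrite addr0 coefX mul1r subn1 coefXn eqSS; case: eqP => _;
    rewrite /= ?rmorph1 ?rmorph0.
by rewrite coefX mul0r.
Qed.

Lemma coef_skewCXnM c m (q : skew) k :
  (skewC c * skewX ^+ m * q)`_k =
  if (m <= k)%N then c * iter m sigma q`_(k - m) else 0.
Proof.
have coefCXn i : (skewC c * skewX ^+ m)`_i = c *+ (i == m).
  rewrite coef_skewM big_ord_recl big1 ?addr0 => [|j _].
    by rewrite coefC /= subn0 skewXnE coefXn mulr_natr.
  by rewrite coefC mul0r.
rewrite coef_skewM; case: leqP => [le_mk | lt_km].
  have lt_mk : (m < k.+1)%N by [].
  rewrite (bigD1 (Ordinal lt_mk)) //= coefCXn eqxx big1 ?addr0 // => i ne_im.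
  by rewrite coefCXn; move: ne_im; rewrite -val_eqE => /negbTE/= ->; rewrite mul0r.
rewrite big1 // => i _; rewrite coefCXn ltn_eqF ?mul0r //.
by rewrite (leq_ltn_trans _ lt_km) // -ltnS.
Qed.

Lemma skewCXnE c m : skewC c * skewX ^+ m = c *: 'X^m :> {poly S}.
Proof.
have -> : skewC c * skewX ^+ m = skewC c * skewX ^+ m * skewC 1.
  by rewrite mulr1.
apply/polyP => k; rewrite coef_skewCXnM coefZ coefXn coefC subn_eq0.
rewrite [k == m]eqn_leq andbC.
by case: leqP => //= _; rewrite ?mulr0 //; case: leqP => _;
  rewrite ?iter_rmorph0 ?iter_rmorph1 ?mulr0.
Qed.

Lemma skewXC c : skewX * skewC c = skewC (sigma c) * skewX.
Proof.
have := skewCXnE (sigma c) 1; rewrite !expr1 => ->.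
have -> : skewX * skewC c = skewC 1 * skewX ^+ 1 * skewC c by rewrite mul1r.
apply/polyP => k; rewrite coef_skewCXnM mul1r coefZ coefX coefC /=.
by case: k => [|[|k]] /=; rewrite ?mulr0 ?mulr1 ?rmorph0.
Qed.

Lemma skew_XnsubC_monic n b : (0 < n)%N -> skewX ^+ n - skewC b \is monic.
Proof. by move=> n_gt0; rewrite skewXnE; apply: monicXnsubC. Qed.

Lemma size_skew_XnsubC n b :
  (0 < n)%N -> size (skewX ^+ n - skewC b) = n.+1.
Proof. by move=> n_gt0; rewrite skewXnE; apply: size_XnsubC. Qed.

Lemma size_skewM (p f : skew) :
  p != 0 -> f \is monic -> size (p * f) = (size p + size f).-1.
Proof.
move=> p_neq0 f_monic; apply/eqP.
have p_gt0 : (0 < size p)%N by rewrite size_poly_gt0.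
have f_gt0 : (0 < size f)%N by rewrite size_poly_gt0 monic_neq0.
rewrite eqn_leq size_poly /=.
have -> : (size p + size f).-1 = ((size p).-1 + (size f).-1).+1.
  by rewrite -{1}(prednK p_gt0) -{1}(prednK f_gt0) addSn addnS.
rewrite ltnNge; apply/negP => /leq_sizeP/(_ _ (leqnn _))/eqP; apply/negP.
rewrite coef_skewM.
have lt_p : ((size p).-1 < ((size p).-1 + (size f).-1).+1)%N.
  by rewrite ltnS leq_addr.
rewrite (bigD1 (Ordinal lt_p)) //= addKn big1 ?addr0 => [|i ne_ip].
  by rewrite -/(lead_coef f) (monicP f_monic) iter_rmorph1 mulr1 lead_coef_eq0.
have [lt_pi | ge_pi] := ltnP (size p).-1 i.
  by rewrite nth_default ?mul0r // (leq_trans (leqSpred _)).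
rewrite [f`__]nth_default ?iter_rmorph0 ?mulr0 //.
have lt_ip : (i < (size p).-1)%N.
  by rewrite ltn_neqAle ge_pi andbT; move: ne_ip; rewrite -val_eqE.
by rewrite -{1}(prednK f_gt0) ltn_subRL ltn_add2r.
Qed.

(* Remainder of the right division g = q * f + r, for f monic: each step      *)
(* cancels the leading term c t^d of g against c t^(d - deg f) * f.           *)
Fixpoint skew_rmod_rec (f : skew) (m : nat) (g : skew) : skew :=
  if m is m'.+1 then
    if (size g < size f)%N then g
    else skew_rmod_rec f m'
           (g - skewC (lead_coef g) * skewX ^+ (size g - size f) * f)
  else g.

Definition skew_rmod (g f : skew) : skew := skew_rmod_rec f (size g) g.

Lemma skew_rmodP (f g : skew) : f \is monic ->
  (size (skew_rmod g f) < size f)%N /\ exists q, g = q * f + skew_rmod g f.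
Proof.
move=> f_monic; have f_gt0 : (0 < size f)%N.
  by rewrite size_poly_gt0 monic_neq0.
rewrite /skew_rmod; move: {2 3 4}(size g) (leqnn (size g)) => m.
elim: m g => [|m IHm] g le_gm /=.
  split; first by rewrite (leq_ltn_trans le_gm).
  by exists 0; rewrite mul0r add0r.
case: ifPn => [lt_gf | ]; first by split=> //; exists 0; rewrite mul0r add0r.
rewrite -leqNgt => le_fg; set h := _ * skewX ^+ _.
have g_gt0 : (0 < size g)%N by exact: leq_trans le_fg.
have [|lt_r [q def_g]] := IHm (g - h * f).
  rewrite -ltnS (leq_trans _ le_gm) // -[X in (_ < X)%N](prednK g_gt0) ltnS.
  apply/leq_sizeP => k le_gk; rewrite coefB coef_skewCXnM.
  have le_dg : (size g - size f <= (size g).-1)%N.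
    by rewrite -subn1 leq_sub2l.
  rewrite (leq_trans le_dg le_gk); move: le_gk; rewrite leq_eqVlt.
  case/orP=> [/eqP<- | lt_gk].
    rewrite -/(lead_coef g) -subn1 subnAC subKn // subn1.
    by rewrite -/(lead_coef f) (monicP f_monic) iter_rmorph1 mulr1 subrr.
  have le_gk : (size g <= k)%N by rewrite -(prednK g_gt0).
  rewrite nth_default // [f`__]nth_default ?iter_rmorph0 ?mulr0 ?subr0 //.
  by rewrite leq_subRL ?subnK // (leq_trans (leq_subr _ _)).
split=> //; exists (h + q).
by rewrite mulrDl -addrA -def_g addrC subrK.
Qed.

Lemma skew_rdiv_uniq (f q1 r1 q2 r2 : skew) : f \is monic ->
    (size r1 < size f)%N -> (size r2 < size f)%N ->
  q1 * f + r1 = q2 * f + r2 -> q1 = q2 /\ r1 = r2.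
Proof.
move=> f_monic lt_r1 lt_r2 eq_qr.
have [eq_q | ne_q] := eqVneq q1 q2.
  by split=> //; move: eq_qr; rewrite eq_q => /addrI.
have eq_r : (q1 - q2) * f = r2 - r1.
  by rewrite mulrBl; apply/eqP; rewrite subr_eq addrAC eq_sym subr_eq eq_qr
    [r2 + _]addrC.
have: (size (r2 - r1)%R < size f)%N.
  by rewrite (leq_ltn_trans (size_polyD _ _)) // size_polyN gtn_max lt_r2.
rewrite -eq_r size_skewM ?subr_eq0 //.
have: (0 < size (q1 - q2)%R)%N by rewrite size_poly_gt0 subr_eq0.
by case: (size (q1 - q2)%R) => //= m _; rewrite ltnNge leq_addl.
Qed.

Lemma skew_rmodE (f g q r : skew) : f \is monic -> (size r < size f)%N ->
  g = q * f + r -> skew_rmod g f = r.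
Proof.
move=> f_monic lt_r def_g; have [lt_m [q' def_g']] := skew_rmodP g f_monic.
by case: (skew_rdiv_uniq f_monic lt_m lt_r (etrans (esym def_g') def_g)).
Qed.

Lemma skew_rmod_small (f g : skew) : f \is monic ->
  (size g < size f)%N -> skew_rmod g f = g.
Proof. by move=> fm lt_gf; apply: (@skew_rmodE _ _ 0); rewrite ?mul0r ?add0r. Qed.

Lemma skew_rmodD (f g h : skew) : f \is monic ->
  skew_rmod (g + h) f = skew_rmod g f + skew_rmod h f.
Proof.
move=> fm; have [lt_g [q def_g]] := skew_rmodP g fm.
have [lt_h [q' def_h]] := skew_rmodP h fm.
apply: (@skew_rmodE _ _ (q + q')) => //.
  by rewrite (leq_ltn_trans (size_polyD _ _)) // gtn_max lt_g.
by rewrite mulrDl addrACA -def_g -def_h.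
Qed.

End SkewPoly.

Arguments skewX {S} sigma.
Arguments skewC {S} sigma c.

Section Petit.
Variables (S : comNzRingType) (sigma : {rmorphism S -> S}).
Variables (f : skewpoly sigma) (f_monic : f \is monic).

Definition petit_pred of f \is monic : {pred skewpoly sigma} :=
  fun p => (size p < size f)%N.

Fact petit_zmod_closed : zmod_closed (petit_pred f_monic).
Proof.
split=> [|p q]; rewrite !unfold_in; last move=> lt_p lt_q.
  by rewrite size_poly0 size_poly_gt0 monic_neq0.
by rewrite (leq_ltn_trans (size_polyD _ _)) // size_polyN gtn_max lt_p.
Qed.

HB.instance Definition _ :=
  GRing.isZmodClosed.Build (skewpoly sigma) (petit_pred f_monic)
    petit_zmod_closed.

(* The Petit ring S_f. It is nonassociative, so it cannot be a ring of the    *)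
(* ssralg hierarchy: its product is the magma product, (x * y)%g, and         *)
(* (x ^+ s)%g is the right-nested power x * (x * ... (x * x)).                *)
Record petit : predArgType := Petit {
  petit_val :> skewpoly sigma;
  _ : petit_val \in petit_pred f_monic
}.

HB.instance Definition _ := [isSub for petit_val].
HB.instance Definition _ := [Choice of petit by <:].
HB.instance Definition _ := [SubChoice_isSubZmodule of petit by <:].

Lemma size_petit (x : petit) : (size (val x) < size f)%N.
Proof. by case: x. Qed.

(* g |-> g mod_r f *)
Definition petit_proj (g : skewpoly sigma) : petit :=
  Petit (proj1 (skew_rmodP g f_monic) : skew_rmod g f \in petit_pred f_monic).

Lemma petit_projK (x : petit) : petit_proj (val x) = x.
Proof. by apply: val_inj; apply: skew_rmod_small => //; apply: size_petit. Qed.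

Lemma val_petit_proj (g : skewpoly sigma) :
  (size g < size f)%N -> val (petit_proj g) = g.
Proof. exact: skew_rmod_small. Qed.

Definition petit_mul (x y : petit) : petit := petit_proj (val x * val y).

HB.instance Definition _ := hasMul.Build petit petit_mul.

Fact petit_mul1x : left_id (petit_proj 1) petit_mul.
Proof.
have [lt_1f | ] := ltnP (size (1 : skewpoly sigma)) (size f).
  by move=> x; rewrite /petit_mul val_petit_proj // mul1r petit_projK.
rewrite size_poly1 => le_f1 x; apply: val_inj.
have eq0 (y : petit) : val y = 0.
  apply/eqP; rewrite -size_poly_eq0 -leqn0 -ltnS.
  exact: leq_trans (size_petit y) le_f1.
by rewrite !eq0.
Qed.

Fact petit_mulx1 : right_id (petit_proj 1) petit_mul.
Proof.
have [lt_1f | ] := ltnP (size (1 : skewpoly sigma)) (size f).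
  by move=> x; rewrite /petit_mul val_petit_proj // mulr1 petit_projK.
rewrite size_poly1 => le_f1 x; apply: val_inj.
have eq0 (y : petit) : val y = 0.
  apply/eqP; rewrite -size_poly_eq0 -leqn0 -ltnS.
  exact: leq_trans (size_petit y) le_f1.
by rewrite !eq0.
Qed.

HB.instance Definition _ :=
  Magma_isUMagma.Build petit petit_mul1x petit_mulx1.

Lemma val_petitM (x y : petit) :
  val (x * y)%g = skew_rmod (val x * val y) f.
Proof. by []. Qed.

Lemma petit_mulDl (x y z : petit) :
  ((x + y)%R * z)%g = (x * z)%g + (y * z)%g.
Proof. by apply: val_inj; rewrite val_petitM raddfD mulrDl skew_rmodD. Qed.

Lemma petit_mulDr (x y z : petit) :
  (x * (y + z)%R)%g = (x * y)%g + (x * z)%g.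
Proof. by apply: val_inj; rewrite val_petitM raddfD mulrDr skew_rmodD. Qed.

End Petit.

(* A parenthesization of a product of s factors is a binary tree with s       *)
(* leaves.                                                                    *)
Inductive parens : Type := PLeaf | PNode of parens & parens.

Fixpoint nleaves (w : parens) : nat :=
  if w is PNode u v then (nleaves u + nleaves v)%N else 1%N.

Fixpoint parens_eval (M : magmaType) (z : M) (w : parens) : M :=
  if w is PNode u v then (parens_eval z u * parens_eval z v)%g else z.

Definition power_associative (M : magmaType) (z : M) : Prop :=
  forall s : nat, (0 < s)%N -> forall u v : parens,
    nleaves u = s -> nleaves v = s -> parens_eval z u = parens_eval z v.

(* Main.v *)
(* Modulo [t^n - b] one has [t^(m+n) = sigma^m(b) t^m], so products of        *)
(* monomials are again monomials. The relation alpha b = sigma^n(alpha)       *)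
(* sigma^k(b) propagates to N_v b = sigma^n(N_v) sigma^(vk)(b) for the norms  *)
(* N_v of alpha, and this is what makes the claimed powers z_s satisfy        *)
(* z_u z_v = z_(u+v); hence any parenthesization with s leaves is z_s.        *)
(* Conversely, z z^s = z^s z for the least s with sk >= n yields the          *)
(* relation after cancelling norms of alpha and conjugates of b.              *)
Require Import Defs.
From mathcomp Require Import all_boot ssralg poly.

Set Implicit Arguments.
Unset Strict Implicit.
Unset Printing Implicit Defensive.

Import GRing.Theory.
Local Open Scope ring_scope.

(** Put f = t^n - b. Reducing a monomial modulo f only multiplies its coefficient by a product of
    conjugates of b ([skew_rmod_mono]), so every claim is an identity between coefficients. The
    relation on alpha and b says f * (alpha t^k) = (sigma^n(alpha) t^k) * f, so the left ideal
    generated by f is stable under right multiplication by alpha t^k. Hence left factors may also be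
    reduced early ([norm_wrapD]), and every parenthesization gives the reduction of (alpha t^k)^s.
    Conversely, at the first exponent s where reduction occurs, z z^s = z^s z already contains the
    relation, up to regular factors and a power of sigma. *)

Lemma inj_iter (T : Type) (f : T -> T) i : injective f -> injective (iter i f).
Proof. by move=> f_inj; elim: i => //= i IHi x y /f_inj/IHi. Qed.

Section PowerAssociativity.
Variables (M : umagmaType) (z : M).

(** The trees that realize the right-nested magma power, linking [z ^+ s] to [parens_eval]. *)
Fixpoint right_comb (s : nat) : parens :=
  if s is s'.+1 then PNode PLeaf (right_comb s') else PLeaf.

Lemma nleaves_right_comb s : nleaves (right_comb s) = s.+1.
Proof. by elim: s => //= s ->. Qed.

Lemma parens_eval_right_comb s : parens_eval z (right_comb s) = (z ^+ s.+1)%g.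
Proof. by elim: s => [|s IHs] /=; rewrite ?expg1 // IHs [RHS]expgS. Qed.

Lemma nleaves_gt0 w : (0 < nleaves w)%N.
Proof. by elim: w => //= u u_gt0 v _; rewrite addn_gt0 u_gt0. Qed.

Lemma power_associative_comm s :
  power_associative z -> (0 < s)%N -> (z * z ^+ s = z ^+ s * z)%g.
Proof.
case: s => // s z_pa _; rewrite -parens_eval_right_comb.
apply: (z_pa s.+2 isT (PNode PLeaf _) (PNode _ PLeaf)) => /=;
  by rewrite nleaves_right_comb ?addn1.
Qed.

Lemma power_associative_seq (e : nat -> M) :
  e 1 = z -> (forall u v, (0 < u)%N -> (0 < v)%N -> (e u * e v)%g = e (u + v)%N) ->
  power_associative z /\ forall s, (0 < s)%N -> (z ^+ s)%g = e s.
Proof.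
move=> e1 eD.
have eE w : parens_eval z w = e (nleaves w).
  by elim: w => //= u -> v ->; rewrite eD ?nleaves_gt0.
split=> [s _ u v su sv | [|s] // _]; first by rewrite !eE su sv.
by rewrite -parens_eval_right_comb eE nleaves_right_comb.
Qed.

End PowerAssociativity.

Section SkewMonomials.
Variables (S : comNzRingType) (sigma : {rmorphism S -> S}).
Local Notation mono c i := (skewC sigma c * skewX sigma ^+ i).

Lemma skew_monoM c d i j :
  mono c i * mono d j = mono (c * iter i sigma d) (i + j).
Proof.
apply/polyP => m; rewrite coef_skewCXnM !skewCXnE !coefZ !coefXn.
case: leqP => [le_im | lt_mi].
  rewrite -[m in RHS](subnKC le_im) eqn_add2l.
  by case: eqP => _; rewrite ?mulr1 // !mulr0 iter_rmorph0 mulr0.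
by rewrite ltn_eqF ?mulr0 // (leq_trans lt_mi) ?leq_addr.
Qed.

Lemma skew_mono_inj i : injective (fun c => mono c i).
Proof.
move=> c d; rewrite /= !skewCXnE => /(congr1 (fun p : {poly S} => p`_i)).
by rewrite !coefZ coefXn eqxx !mulr1.
Qed.

Lemma skew_norm0 (rho : S -> S) a : skew_norm rho 0 a = 1.
Proof. by rewrite /skew_norm big_geq. Qed.

Lemma skew_norm1 (rho : S -> S) a : skew_norm rho 1 a = a.
Proof. by rewrite /skew_norm big_nat1. Qed.

Lemma skew_normS k s a :
  skew_norm (iter k sigma) s.+1 a = a * iter k sigma (skew_norm (iter k sigma) s a).
Proof.
rewrite /skew_norm big_nat_recl //=; congr (_ * _).
by rewrite (big_morph _ (iter_rmorphM sigma k) (iter_rmorph1 sigma k)).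
Qed.

Lemma skew_normD k u v a :
  skew_norm (iter k sigma) (u + v) a =
  skew_norm (iter k sigma) u a * iter (u * k) sigma (skew_norm (iter k sigma) v a).
Proof.
elim: u => [|u IHu]; first by rewrite skew_norm0 mul1r.
by rewrite addSn !skew_normS IHu iter_rmorphM mulrA mulSn iterD.
Qed.

(** Surjectivity of sigma lets the elements tested against sigma(c) be pulled back and tested
    against c. *)
Lemma iter_lreg i c :
  bijective sigma -> GRing.lreg c -> GRing.lreg (iter i sigma c).
Proof.
move=> [tau sigmaK tauK] c_reg; elim: i => //= i IHi x y.
by rewrite -[x]tauK -[y]tauK -!rmorphM => /(can_inj sigmaK)/IHi->.
Qed.

Lemma skew_norm_lreg k s a :
  bijective sigma -> GRing.lreg a -> GRing.lreg (skew_norm (iter k sigma) s a).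
Proof.
move=> sigma_bij a_reg; elim: s => [|s IHs].
  by rewrite skew_norm0; apply: lreg1.
by rewrite skew_normS; apply: lregM => //; apply: iter_lreg.
Qed.

Variables (b : S) (n : nat).

(* The coefficient left behind when [t^m] is reduced modulo [t^n - b], i.e. *)
(* [t^m = wrap m t^(m %% n)] in the Petit ring.                             *)
Definition wrap (m : nat) : S :=
  \prod_(1 <= i < (m %/ n).+1) iter (m - i * n) sigma b.

Lemma wrap_small m : (m < n)%N -> wrap m = 1.
Proof. by move=> lt_mn; rewrite /wrap divn_small // big_geq. Qed.

Hypothesis n_gt0 : (0 < n)%N.

Lemma wrapDn m : wrap (n + m) = iter m sigma b * wrap m.
Proof.
rewrite /wrap divnDl ?dvdnn // divnn n_gt0 add1n big_nat_recl //.
rewrite mul1n addKn; congr (_ * _).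
by apply: eq_bigr => i _; rewrite mulSn subnDl.
Qed.

(** Each inductive step accounts for a single replacement of t^n by b. *)
Lemma modn_ind (P : nat -> Prop) :
  (forall m, (m < n)%N -> P m) -> (forall m, P m -> P (n + m)%N) -> forall m, P m.
Proof.
move=> P0 PD m; rewrite (divn_eq m n); elim: (m %/ n)%N => [|q IHq].
  by apply: P0; rewrite ltn_pmod.
by rewrite mulSn -addnA; apply: PD.
Qed.

Lemma wrapD_small m p : (m < n)%N ->
  iter m sigma (wrap p) * wrap (m + p %% n) = wrap (m + p).
Proof.
move=> lt_mn; elim/modn_ind: p => [p lt_pn | p IHp].
  by rewrite wrap_small // iter_rmorph1 mul1r modn_small.
by rewrite modnDl wrapDn iter_rmorphM -iterD -mulrA IHp addnCA wrapDn.
Qed.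

Lemma wrap_lreg m : bijective sigma -> GRing.lreg b -> GRing.lreg (wrap m).
Proof.
move=> sigma_bij b_reg; elim/modn_ind: m => [m lt_mn | m IHm].
  by rewrite wrap_small //; apply: lreg1.
by rewrite wrapDn; apply: lregM => //; apply: iter_lreg.
Qed.

Lemma skew_rmod_mono c m :
  skew_rmod (mono c m) (skewX sigma ^+ n - skewC sigma b) =
  mono (c * wrap m) (m %% n).
Proof.
have f_monic := skew_XnsubC_monic sigma b n_gt0.
have [q def_q] : exists q, mono c m =
    q * (skewX sigma ^+ n - skewC sigma b) + mono (c * wrap m) (m %% n).
  elim/modn_ind: m c => [m lt_mn | m IHm] c.
    by exists 0; rewrite mul0r add0r wrap_small // mulr1 modn_small.
  have [q def_q] := IHm (c * iter m sigma b).
  (* One division step: c t^(m+n) = c t^m (t^n - b) + c sigma^m(b) t^m. *)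
  exists (mono c m + q); rewrite modnDl wrapDn mulrA mulrDl -addrA -def_q.
  have := skew_monoM c b m 0; rewrite expr0 mulr1 addn0 => <-.
  by rewrite mulrBr subrK -mulrA -exprD addnC.
apply: (skew_rmodE f_monic) def_q.
rewrite size_skew_XnsubC // skewCXnE ltnS (leq_trans (size_scale_leq _ _)) //.
by rewrite size_polyXn ltn_pmod.
Qed.

Lemma val_petitM_mono (x y : petit (skew_XnsubC_monic sigma b n_gt0)) c d i j :
    val x = mono c i -> val y = mono d j ->
  val (x * y)%g = mono (c * iter i sigma d * wrap (i + j)) ((i + j) %% n).
Proof.
by move=> def_x def_y; rewrite val_petitM def_x def_y skew_monoM skew_rmod_mono.
Qed.

Section Twist.
Variables (a : S) (k : nat).
Local Notation norm s := (skew_norm (iter k sigma) s a).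
Hypothesis ab_twist : a * b = iter n sigma a * iter k sigma b.

(** The twist relation for [norm s] t^(sk), which is (alpha t^k)^s in the skew polynomial ring; the
    relation is stable under products of monomials. *)
Lemma norm_twist s : norm s * b = iter n sigma (norm s) * iter (s * k) sigma b.
Proof.
elim: s => [|s IHs].
  by rewrite skew_norm0 iter_rmorph1.
rewrite skew_normS mulrAC ab_twist -mulrA -iter_rmorphM [b * _]mulrC IHs.
by rewrite !iter_rmorphM mulrA -!iterD addnC mulSn.
Qed.

(** Reducing t^m before multiplying by the v-th power changes nothing: it turns sigma^m into
    sigma^(m mod n) on [norm v], and [norm_twist] compensates for each t^n replaced by b. *)
Lemma norm_wrapD m v :
  wrap m * iter (m %% n) sigma (norm v * wrap (v * k)) * wrap (m %% n + (v * k) %% n)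
  = iter m sigma (norm v) * wrap (m + v * k).
Proof.
rewrite iter_rmorphM -!mulrA wrapD_small ?ltn_pmod //.
elim/modn_ind: m => [m lt_mn | m IHm].
  by rewrite wrap_small // mul1r modn_small.
rewrite modnDl wrapDn -mulrA IHm mulrA -iter_rmorphM [b * _]mulrC norm_twist.
by rewrite iter_rmorphM -!iterD -mulrA -addnA wrapDn [(m + n)%N]addnC.
Qed.

End Twist.

End SkewMonomials.

Theorem theorem3p3 (S : comNzRingType) (sigma : {rmorphism S -> S})
    (sigma_bij : bijective sigma)
    (sigma_finite_order : exists m : nat, (0 < m)%N /\ iter m sigma =1 id)
    (alpha b : S) (alpha_reg : GRing.lreg alpha) (b_reg : GRing.lreg b)
    (n k : nat) (k_gt0 : (0 < k)%N) (lt_kn : (k < n)%N)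
    (z : petit (skew_XnsubC_monic sigma b (ltn_trans k_gt0 lt_kn)))
    (z_def : val z = skewC sigma alpha * skewX sigma ^+ k) :
  (power_associative z ->
     alpha * b = iter n sigma alpha * iter k sigma b) /\
  (alpha * b = iter n sigma alpha * iter k sigma b ->
     power_associative z /\
     forall s : nat, (0 < s)%N ->
       val (z ^+ s)%g =
         skewC sigma (skew_norm (iter k sigma) s alpha *
                      \prod_(1 <= i < ((s * k) %/ n).+1)
                         iter (s * k - i * n) sigma b)
         * skewX sigma ^+ ((s * k) %% n)).
Proof.
have n_gt0 := ltn_trans k_gt0 lt_kn.
split=> [z_pa | ab_twist].
- (* [m.+1] is the least s with n <= s * k. *)
  pose m := (n.-1 %/ k)%N; pose e := (m.+1 * k - n)%N.
  have le_mk : (m * k < n)%N by rewrite -[X in (_ < X)%N](prednK n_gt0) ltnS leq_divM.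
  have le_n : (n <= m.+1 * k)%N by rewrite -(prednK n_gt0) ltn_ceil.
  have lt_en : (e < n)%N.
    by rewrite /e ltn_subLR // mulSn -addnS leq_add // ltnW.
  have def_mk : (m.+1 * k = n + e)%N by rewrite subnKC.
  have zX s : (0 < s)%N -> (s <= m)%N -> val (z ^+ s)%g =
      skewC sigma (skew_norm (iter k sigma) s alpha) * skewX sigma ^+ (s * k).
    elim: s => // -[|s] IHs _ le_sm; first by rewrite expg1 skew_norm1 mul1n.
    have lt_sk : (k + s.+1 * k < n)%N.
      by rewrite -mulSn (leq_ltn_trans _ le_mk) // leq_mul2r le_sm orbT.
    rewrite expgS (val_petitM_mono z_def (IHs isT (ltnW le_sm))).
    by rewrite -skew_normS wrap_small // mulr1 modn_small // mulSn.
  have m_gt0 : (0 < m)%N by rewrite divn_gt0 // -ltnS (prednK n_gt0).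
  have zXm : val (z ^+ m.+1)%g =
      skewC sigma (skew_norm (iter k sigma) m.+1 alpha * iter e sigma b) *
        skewX sigma ^+ e.
    rewrite expgS (val_petitM_mono z_def (zX m m_gt0 (leqnn m))) -mulSn def_mk.
    by rewrite -skew_normS wrapDn // [wrap _ _ _ e]wrap_small // mulr1 modnDl modn_small.
  (* Both products have degree (k + e) mod n and share the factor [wrap] at k + e, which is regular
     and cancels. *)
  have := congr1 val (power_associative_comm z_pa (ltn0Sn m)).
  rewrite (val_petitM_mono z_def zXm) (val_petitM_mono zXm z_def) [(e + k)%N]addnC.
  move/skew_mono_inj; rewrite ![_ * wrap _ _ _ _]mulrC.
  move/(wrap_lreg n_gt0 sigma_bij b_reg); rewrite iter_rmorphM mulrA -skew_normS.
  (* Splitting off the last factor of the norm, sigma^(n+e)(alpha), leaves a common regular norm to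
     cancel; what remains is sigma^e applied to the relation. *)
  rewrite -[m.+2 in LHS]addn1 skew_normD skew_norm1 -!mulrA.
  move/(skew_norm_lreg sigma_bij alpha_reg).
  rewrite def_mk -!iterD ![(_ + e)%N]addnC !iterD.
  rewrite -!iter_rmorphM => /(inj_iter (bij_inj sigma_bij)) eq_ab.
  by rewrite eq_ab mulrC.
- pose e s := petit_proj (skew_XnsubC_monic sigma b (ltn_trans k_gt0 lt_kn))
    (skewC sigma (skew_norm (iter k sigma) s alpha * wrap sigma b n (s * k)) *
       skewX sigma ^+ ((s * k) %% n)).
  have eE s : val (e s) = skewC sigma
      (skew_norm (iter k sigma) s alpha * wrap sigma b n (s * k)) *
        skewX sigma ^+ ((s * k) %% n).
    rewrite val_petit_proj // size_skew_XnsubC // skewCXnE ltnS.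
    by rewrite (leq_trans (size_scale_leq _ _)) // size_polyXn ltn_pmod.
  have [] := @power_associative_seq _ z e.
  + by apply: val_inj; rewrite eE z_def mul1n wrap_small // skew_norm1 mulr1 modn_small.
  + move=> u v _ _; apply: val_inj; rewrite (val_petitM_mono (eE u) (eE v)) eE.
    rewrite modnDm -mulnDl; congr (skewC sigma _ * _).
    (* [norm_wrapD] with m = uk merges the wrap factors, and [skew_normD] the norms. *)
    by rewrite -!mulrA [X in _ * X]mulrA norm_wrapD // mulrA -skew_normD mulnDl.
  + by move=> z_pa zE; split=> // s s_gt0; rewrite zE // eE.
Qed.
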